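(* RDARP is polynomial-time reducible to RDARP-B. Moreover, RDARP restricted to instances with uniform revenues is polynomial-time reducible to RDARP-B restricted to instances with uniform revenues.
   Context: RDARP (offline revenue dial-a-ride): given a complete undirected graph $G=(V,E)$ with positive edge weights (travel times), an origin $o\in V$, a time limit $T$, and a set of requests $(s,d,t,p)$ (source, destination, release time, revenue), all known in advance, and a threshold $R$, decide whether a single unit-capacity server starting at $o$ at time $0$ can earn total revenue at least $R$ by time $T$, where serving a request means travelling to $s$ and then from $s$ to $d$, departing $s$ no earlier than $t$, carrying at most one request at a time, non-preemptively, and revenue is earned for requests completed by time $T$. RDARP-B is the same problem where the graph is a complete bipartite graph with parts $V_1,V_2$ and positive edge weights, every request source lies in $V_1$, every destination lies in $V_2$, the origin lies in $V_2$ (and is adjacent to every node of $V_1$), and the server moves along edges of this graph; no lower bound on edge weights is imposed. ''Uniform revenues'' means all requests have the same revenue. *)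

(* Defs.v *)
From HB Require Import structures.
From mathcomp Require Import all_boot all_order all_algebra.

Set Implicit Arguments.
Unset Strict Implicit.
Unset Printing Implicit Defensive.
Import Order.TTheory GRing.Theory Num.Theory.

Local Open Scope ring_scope.

Inductive move := MoveLeft | Stay | MoveRight.

(* The tapes are indexed by 'I_ntapes.+1: the input is on tape [ord0] and the
   output on tape [ord_max]. The tape alphabet is [cell M], with [None] the
   blank symbol. *)
Record machine (A : finType) := Machine {
  ntapes : nat;
  aux : finType;
  state : finType;
  start : state;
  halting : pred state;
  trans : state -> {ffun 'I_ntapes.+1 -> option (A + aux)} ->
          state * {ffun 'I_ntapes.+1 -> option (A + aux) * move}
}.

Section Machine.
Variables (A : finType) (M : machine A).

Definition cell : Type := option (A + aux M).

(* A two-way infinite tape, blank outside of the listed cells: [tleft] lists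
   the cells to the left of the head, nearest first, and [tright] the scanned
   cell followed by the cells to its right. *)
Record tape := Tape { tleft : seq cell; tright : seq cell }.

Definition scan (t : tape) : cell := head None (tright t).

Definition write_move (t : tape) (a : cell * move) : tape :=
  let l := tleft t in
  let r := a.1 :: behead (tright t) in
  match a.2 with
  | MoveLeft => Tape (behead l) (head None l :: r)
  | Stay => Tape l r
  | MoveRight => Tape (a.1 :: l) (behead r)
  end.

Definition config : Type := (state M * {ffun 'I_(ntapes M).+1 -> tape})%type.

Definition step (c : config) : config :=
  if halting c.1 then c else
  let qa := trans c.1 [ffun i => scan (c.2 i)] in
  (qa.1, [ffun i => write_move (c.2 i) (qa.2 i)]).

Definition word_cells (w : seq A) : seq cell := [seq Some (inl x) | x <- w].

Definition init (w : seq A) : config :=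
  (start M, [ffun i => Tape [::] (if i == ord0 then word_cells w else [::])]).

Definition tape_holds (t : tape) (w : seq A) : Prop :=
  exists i j : nat,
    rev (tleft t) ++ tright t = nseq i None ++ word_cells w ++ nseq j None.

Definition computes_within (w v : seq A) (b : nat) : Prop :=
  exists2 t : nat, (t <= b)%N &
    let c := iter t step (init w) in
    halting c.1 /\ tape_holds (c.2 ord_max) v.

End Machine.

Record problem (A : finType) := Problem {
  instance : Type;
  valid : instance -> Prop;
  yes : instance -> Prop;
  code : instance -> seq A
}.

Definition restrict (A : finType) (P : problem A) (S : instance P -> Prop) :
    problem A :=
  Problem (fun x => valid x /\ S x) (@yes A P) (@code A P).

Definition poly_time (A : finType) (P Q : problem A)
    (f : instance P -> instance Q) : Prop :=
  exists (M : machine A) (c k : nat), forall x : instance P, valid x ->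
    computes_within M (code x) (code (f x)) (c * size (code x) ^ k + c)%N.

Definition poly_reducible (A : finType) (P Q : problem A) : Prop :=
  exists f : instance P -> instance Q,
    [/\ forall x, valid x -> valid (f x),
        forall x, valid x -> (yes x <-> yes (f x))
      & poly_time f].

Record request (S D : Type) := Request {
  source : S;
  dest : D;
  release : rat;
  revenue : rat
}.

Record dial_a_ride := DialARide {
  site : finType;
  adjacent : rel site;
  travel : site -> site -> rat;
  origin : site;
  time_limit : rat;
  requests : seq (request site site);
  threshold : rat
}.

Section Server.
Variable I : dial_a_ride.

Definition req_index : finType := 'I_(size (requests I)).
Definition req (i : req_index) : request (site I) (site I) :=
  tnth (in_tuple (requests I)) i.

Record server := Server {
  position : site I;
  clock : rat;
  load : option req_index;
  served : {set req_index}
}.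

(* Waiting is always possible, and a request may be carried along any walk
   from its source to its destination; but it can only be put down at its
   destination, and only one request is carried at a time. *)
Inductive reachable : server -> Prop :=
| reach_start : reachable (Server (origin I) 0 None set0)
| reach_wait v t l S (d : rat) :
    reachable (Server v t l S) -> 0 <= d ->
    reachable (Server v (t + d) l S)
| reach_move u v t l S :
    reachable (Server u t l S) -> adjacent u v ->
    reachable (Server v (t + travel u v) l S)
| reach_pickup t S (i : req_index) :
    reachable (Server (source (req i)) t None S) ->
    i \notin S -> release (req i) <= t ->
    reachable (Server (source (req i)) t (Some i) S)
| reach_deliver t S (i : req_index) :
    reachable (Server (dest (req i)) t (Some i) S) ->
    reachable (Server (dest (req i)) t None (i |: S)).

Definition can_earn : Prop :=
  exists x : server,
    [/\ reachable x, clock x <= time_limit I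
      & threshold I <= \sum_(i in served x) revenue (req i)].

End Server.

Definition valid_requests (S D : Type) (rs : seq (request S D)) : bool :=
  all (fun r => (0 <= release r) && (0 <= revenue r)) rs.

Definition uniform_revenues (S D : Type) (rs : seq (request S D)) : bool :=
  constant [seq revenue r | r <- rs].

Record rdarp := Rdarp {
  r_size : nat;
  r_weight : 'M[rat]_r_size;
  r_origin : 'I_r_size;
  r_limit : rat;
  r_requests : seq (request 'I_r_size 'I_r_size);
  r_threshold : rat
}.

(* There are no loops; the diagonal of the weight matrix is 0 by convention. *)
Definition rdarp_valid (I : rdarp) : Prop :=
  [/\ forall u v : 'I_(r_size I), r_weight I u v = r_weight I v u,
      forall u : 'I_(r_size I), r_weight I u u = 0,
      forall u v : 'I_(r_size I), u != v -> 0 < r_weight I u v,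
      0 <= r_limit I /\ 0 <= r_threshold I
    & valid_requests (r_requests I)].

Definition rdarp_ride (I : rdarp) : dial_a_ride :=
  @DialARide 'I_(r_size I) (fun u v => u != v) (fun u v => r_weight I u v)
    (r_origin I) (r_limit I) (r_requests I) (r_threshold I).

(* The parts are V_1 = 'I_b_size1 and V_2 = 'I_b_size2. *)
Record rdarpb := Rdarpb {
  b_size1 : nat;
  b_size2 : nat;
  b_weight : 'M[rat]_(b_size1, b_size2);
  b_origin : 'I_b_size2;
  b_limit : rat;
  b_requests : seq (request 'I_b_size1 'I_b_size2);
  b_threshold : rat
}.

Definition rdarpb_valid (I : rdarpb) : Prop :=
  [/\ forall (u : 'I_(b_size1 I)) (v : 'I_(b_size2 I)), 0 < b_weight I u v,
      0 <= b_limit I,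
      0 <= b_threshold I
    & valid_requests (b_requests I)].

Definition bip_adjacent (V1 V2 : Type) (x y : V1 + V2) : bool :=
  match x, y with
  | inl _, inr _ | inr _, inl _ => true
  | _, _ => false
  end.

Definition bip_travel (n1 n2 : nat) (w : 'M[rat]_(n1, n2))
    (x y : 'I_n1 + 'I_n2) : rat :=
  match x, y with
  | inl u, inr v | inr v, inl u => w u v
  | _, _ => 0
  end.

Definition bip_request (V1 V2 : Type) (r : request V1 V2) :
    request (V1 + V2) (V1 + V2) :=
  Request (inl (source r)) (inr (dest r)) (release r) (revenue r).

Definition rdarpb_ride (I : rdarpb) : dial_a_ride :=
  @DialARide ('I_(b_size1 I) + 'I_(b_size2 I))%type
    (@bip_adjacent 'I_(b_size1 I) 'I_(b_size2 I)) (bip_travel (b_weight I))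
    (inr (b_origin I)) (b_limit I)
    [seq bip_request r | r <- b_requests I] (b_threshold I).

Inductive symbol := Bit of bool | Slash | Comma | Semi | Hash.

Definition symbol_to (s : symbol) : option (option (option (option bool))) :=
  match s with
  | Bit b => Some (Some (Some (Some b)))
  | Slash => Some (Some (Some None))
  | Comma => Some (Some None)
  | Semi => Some None
  | Hash => None
  end.

Definition symbol_of (o : option (option (option (option bool)))) : symbol :=
  match o with
  | Some (Some (Some (Some b))) => Bit b
  | Some (Some (Some None)) => Slash
  | Some (Some None) => Comma
  | Some None => Semi
  | None => Hash
  end.

Lemma symbol_toK : cancel symbol_to symbol_of.
Proof. by case. Qed.

HB.instance Definition _ := Finite.copy symbol (can_type symbol_toK).

Fixpoint pos_bits (p : BinNums.positive) : seq bool :=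
  match p with
  | BinNums.xH => [:: true]
  | BinNums.xO p' => false :: pos_bits p'
  | BinNums.xI p' => true :: pos_bits p'
  end.

(* Binary notation, least significant bit first; 0 is the empty word. *)
Definition nat_code (n : nat) : seq symbol :=
  if bin_of_nat n is BinNums.Npos p then [seq Bit b | b <- pos_bits p]
  else [::].

(* Only used for nonnegative rationals; [numq] and [denq] are coprime. *)
Definition rat_code (q : rat) : seq symbol :=
  nat_code `|numq q|%N ++ Slash :: nat_code `|denq q|%N.

Definition matrix_code (m n : nat) (w : 'M[rat]_(m, n)) : seq symbol :=
  flatten [seq rcons (flatten [seq rcons (rat_code (w i j)) Comma
                              | j <- enum 'I_n]) Semi
          | i <- enum 'I_m].

Definition request_code (m n : nat) (r : request 'I_m 'I_n) : seq symbol :=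
  nat_code (source r) ++ Comma :: nat_code (dest r) ++ Comma ::
  rat_code (release r) ++ Comma :: rat_code (revenue r) ++ [:: Semi].

Definition requests_code (m n : nat) (rs : seq (request 'I_m 'I_n)) :
    seq symbol :=
  flatten [seq request_code r | r <- rs].

Definition rdarp_code (I : rdarp) : seq symbol :=
  nat_code (r_size I) ++ Hash ::
  matrix_code (r_weight I) ++ Hash ::
  nat_code (r_origin I) ++ Hash ::
  rat_code (r_limit I) ++ Hash ::
  requests_code (r_requests I) ++ Hash ::
  rat_code (r_threshold I).

Definition rdarpb_code (I : rdarpb) : seq symbol :=
  nat_code (b_size1 I) ++ Comma :: nat_code (b_size2 I) ++ Hash ::
  matrix_code (b_weight I) ++ Hash ::
  nat_code (b_origin I) ++ Hash ::
  rat_code (b_limit I) ++ Hash ::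
  requests_code (b_requests I) ++ Hash ::
  rat_code (b_threshold I).

Definition RDARP : problem symbol :=
  Problem rdarp_valid (fun I => can_earn (rdarp_ride I)) rdarp_code.

Definition RDARP_B : problem symbol :=
  Problem rdarpb_valid (fun I => can_earn (rdarpb_ride I)) rdarpb_code.

Definition RDARP_uniform : problem symbol :=
  @restrict symbol RDARP (fun I : rdarp => uniform_revenues (r_requests I)).

Definition RDARP_B_uniform : problem symbol :=
  @restrict symbol RDARP_B (fun I : rdarpb => uniform_revenues (b_requests I)).

(* Main.v *)
(** The server graph is doubled: every vertex [u] gets a copy in each part, the
    edge between the copies of distinct [u] and [v] keeps its weight, and the
    edge between the two copies of [u] gets a tiny weight [eps].  A walk of the
    original server lifts to the doubled graph, and it has to be on a given
    side only when it picks up or delivers, so it crosses at most twice per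
    request; the time limit is raised by a tiny amount that pays for these
    crossings.  Conversely, crossings are replaced by waiting, and rounding
    every clock value down to a multiple of [1/D], with [D] a common
    denominator of the weights, release times and time limit, keeps a schedule
    feasible, so an excess below [1/D] over the time limit disappears.

    With [L] the length of the input, [eps = 2^-2L] and the new limit
    [a/b + 2^-(|b|+L)] have codes that are obtained from the input by copying
    and padding, without arithmetic.  The Turing machine needs only a unary
    counter of length [L]; it recognises the diagonal entries of the weight
    matrix because the code of a rational starts with a slash only if the
    rational is zero. *)

From HB Require Import structures.
From mathcomp Require Import all_boot all_order all_algebra.
From mathcomp Require Import zify ring lra.
Require Import Defs.

Set Implicit Arguments.
Unset Strict Implicit.
Unset Printing Implicit Defensive.
Import Order.TTheory GRing.Theory Num.Theory.

Local Open Scope ring_scope.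

(** * Doubling the graph *)

Definition split_instance (I : rdarp) (eps limit : rat) : rdarpb :=
  @Rdarpb (r_size I) (r_size I)
    (\matrix_(u, v) if u == v then eps else r_weight I u v)
    (r_origin I) limit (r_requests I) (r_threshold I).

(** Pickup checks that the request is unserved, and the served set grows only at a delivery, which
    empties the load. Hence each delivery really enlarges the served set, as the crossing count
    needs. *)
Lemma loaded_unserved (J : dial_a_ride) (x : server J) (i : req_index J) :
  reachable x -> load x = Some i -> i \notin served x.
Proof.
move=> rx; elim: rx i => //=.
by move=> t S j _ _ jS _ i [<-].
Qed.

Section SplitInstance.
Variables (I : rdarp) (eps limit : rat).
Hypothesis I_valid : rdarp_valid I.
Hypothesis eps_gt0 : 0 < eps.

Let A := rdarp_ride I.
Let B := rdarpb_ride (split_instance I eps limit).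

Let size_requestsB : size (requests A) = size (requests B).
Proof. by rewrite /= size_map. Qed.

Let lift_req : req_index A -> req_index B := cast_ord size_requestsB.
Let drop_req : req_index B -> req_index A := cast_ord (esym size_requestsB).

Let lift_reqK : cancel lift_req drop_req.
Proof. exact: cast_ordK. Qed.
Let drop_reqK : cancel drop_req lift_req.
Proof. exact: cast_ordKV. Qed.

Let req_lift (i : req_index A) : req (lift_req i) = bip_request (req i).
Proof.
rewrite /req !(tnth_nth (req (lift_req i))) /=.
rewrite (nth_map (req i)) ?(tnth_nth (req i)) //.
Qed.

Let req_drop (i : req_index B) : req i = bip_request (req (drop_req i)).
Proof. by rewrite -req_lift drop_reqK. Qed.

Let weight_eq u : b_weight (split_instance I eps limit) u u = eps.
Proof. by rewrite mxE eqxx. Qed.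

Let weight_neq u v : u != v ->
  b_weight (split_instance I eps limit) u v = r_weight I u v.
Proof. by move=> uv; rewrite mxE (negPf uv). Qed.

Definition on_side (side : bool) (v : site A) : site B :=
  if side then inl v else inr v.

(** A budget: one crossing to reach the source side before a pickup, one to reach the destination
    side before a delivery. A request still on board has used only the first. *)
Definition crossings (x : server A) : nat :=
  (2 * #|served x| + (load x != None))%N.

Let cross side v t l S :
  reachable (Server (on_side side v) t l S) ->
  reachable (I := B) (Server (on_side (~~ side) v) (t + eps) l S).
Proof.
move=> r; have := reach_move (v := on_side (~~ side) v) r.
by case: side r => /= r; rewrite weight_eq; apply.
Qed.

Let to_side side side' v t l S :
  reachable (Server (on_side side v) t l S) ->
  exists t' : rat, [/\ t <= t', t' <= t + eps &
    reachable (I := B) (Server (on_side side' v) t' l S)].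
Proof.
have e0 := eps_gt0; case: (eqVneq side side') => [<- | ss'] r.
  by exists t; split=> //; lra.
exists (t + eps); split=> //; first by lra.
by have := cross r; case: side side' ss' {r} => [] [].
Qed.

(** An ordinary edge switches sides at no extra cost, so the side is not prescribed. Only a pickup
    or a delivery forces it, and each raises [crossings] by one. A delayed clock still satisfies the
    release times. *)
Lemma split_simulates (x : server A) : reachable x ->
  exists (side : bool) (t : rat),
    [/\ clock x <= t, t <= clock x + (crossings x)%:R * eps &
    reachable (I := B) (Server (on_side side (position x)) t
      (omap lift_req (load x)) (lift_req @: served x))].
Proof.
have lift_inj := can_inj lift_reqK; have e0 := eps_gt0.
elim=> [|v t l S d _ [side [t' [le ge r]]] d0|u v t l S _ [side [t' [le ge r]]] uv
       |t S i _ [side [t' [le ge r]]] iS rel|t S i r0 [side [t' [le ge r]]]] /=.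
- exists false, 0; rewrite imset0 /crossings cards0 /= mul0r addr0.
  by split=> //; exact: reach_start.
- exists side, (t' + d); move: le ge; rewrite /= /crossings /= => le ge.
  by split; [lra|lra|exact: reach_wait].
- exists (~~ side), (t' + r_weight I u v); move: le ge; rewrite /= /crossings /=.
  move=> le ge; split; [lra|lra|].
  have := reach_move (v := on_side (~~ side) v) r.
  case: (I_valid) => sym _ _ _ _.
  case: side {r} => /=; rewrite weight_neq //; try by apply.
    by rewrite sym; apply.
  by rewrite eq_sym.
(* Sources lie in the first part, so a pickup needs side [true]; a delivery, below, needs side
   [false]. *)
- move: le ge; rewrite /= /crossings /= addn0 => le ge.
  have [t2 [le2 ge2 r2]] := to_side true r.
  exists true, t2; split; [lra|rewrite natrD mulrDl mul1r; lra|].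
  have := @reach_pickup B t2 (lift_req @: S) (lift_req i).
  rewrite req_lift /=; apply=> //.
    by rewrite mem_imset.
  exact: le_trans rel (le_trans le le2).
- move: le ge; rewrite /= /crossings /= => le ge.
  have [t2 [le2 ge2 r2]] := to_side false r.
  exists false, t2; have iS := loaded_unserved r0 (erefl (Some i)).
  rewrite cardsU1 iS imsetU1 mulnDr addn0 muln1.
  move: ge; rewrite !natrD !mulrDl mul1r => ge; split; [lra|lra|].
  have := @reach_deliver B t2 (lift_req @: S) (lift_req i).
  by rewrite req_lift /=; apply.
Qed.

Definition merge_side (v : site B) : site A :=
  match v with inl u => u | inr u => u end.

(** An edge between the two copies of a vertex projects to a wait of length [eps], so the projected
    schedule keeps exactly the same clock. *)
Lemma split_simulated (x : server B) : reachable x ->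
  reachable (I := A) (Server (merge_side (position x)) (clock x)
    (omap drop_req (load x)) (drop_req @: served x)).
Proof.
have drop_inj := can_inj drop_reqK.
elim=> [|v t l S d _ r d0|u v t l S _ r uv|t S i _ r iS rel|t S i _ r] /=.
- by rewrite imset0; exact: reach_start.
- exact: reach_wait.
- case: (I_valid) => sym _ _ _ _.
  have [uv'|uv'] := eqVneq (merge_side u) (merge_side v).
    suff -> : bip_travel (b_weight (split_instance I eps limit)) u v = eps.
      by rewrite -uv'; apply: reach_wait => //; exact: ltW.
    by case: u v uv uv' {r} => u [] v //= _ ->; rewrite weight_eq.
  suff -> : bip_travel (b_weight (split_instance I eps limit)) u v =
      r_weight I (merge_side u) (merge_side v).
    exact: (reach_move r).
  by case: u v uv uv' {r} => u [] v //= _ uv';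
    rewrite weight_neq // 1?eq_sym // sym.
- move: r rel; rewrite req_drop /= => r rel.
  by apply: reach_pickup => //; rewrite mem_imset.
- by move: r; rewrite req_drop /= imsetU1; exact: reach_deliver.
Qed.

Let revenue_lift (S : {set req_index A}) :
  \sum_(i in lift_req @: S) revenue (req i) = \sum_(i in S) revenue (req i).
Proof.
rewrite big_imset /=; last by move=> i j _ _; exact: can_inj lift_reqK i j.
by apply: eq_bigr => i _; rewrite req_lift.
Qed.

Let revenue_drop (S : {set req_index B}) :
  \sum_(i in drop_req @: S) revenue (req i) = \sum_(i in S) revenue (req i).
Proof.
rewrite big_imset /=; last by move=> i j _ _; exact: can_inj drop_reqK i j.
by apply: eq_bigr => i _; rewrite [in RHS]req_drop.
Qed.

Lemma can_earn_split :
  r_limit I + (2 * size (r_requests I) + 1)%:R * eps <= limit ->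
  can_earn A -> can_earn B.
Proof.
move=> limit_le [x [rx xT xR]].
have [side [t [_ tle rt]]] := split_simulates rx.
eexists; split; [exact: rt | | by rewrite /= revenue_lift].
apply: le_trans tle (le_trans _ limit_le); apply: lerD => //.
apply: ler_wpM2r; first exact: ltW.
(* At most all requests are served, at two crossings each, and a load accounts for at most one
   more. *)
rewrite ler_nat /crossings leq_add ?leq_b1 // leq_mul2l /=.
by have := max_card (mem (served x)); rewrite card_ord.
Qed.

(** * Rounding schedules down to multiples of [1/D] *)

Section Grid.
Variable D : nat.
Hypothesis D_gt0 : (0 < D)%N.

Definition on_grid (q : rat) := q * D%:R \is a Num.int.

Definition round (t : rat) : rat := (Num.floor (t * D%:R))%:~R / D%:R.

Let D_pos : 0 < D%:R :> rat.
Proof. by rewrite ltr0n. Qed.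

Let round_grid q t : on_grid q -> q <= t -> q <= round t.
Proof.
move=> /intrP[m qm] qt; rewrite /round ler_pdivlMr // qm ler_int.
by rewrite floor_ge_int -qm ler_wpM2r // ltW.
Qed.

Let round_mono s t : s <= t -> round s <= round t.
Proof.
move=> st; rewrite /round ler_pM2r ?invr_gt0 // ler_int.
by apply: le_floor; rewrite ler_wpM2r // ltW.
Qed.

Let roundD q t : on_grid q -> round (t + q) = round t + q.
Proof.
move=> /intrP[m qm]; rewrite /round mulrDl qm floorDrz ?intr_int //.
rewrite intrKfloor intrD -qm; field; exact: lt0r_neq0.
Qed.

Hypothesis weight_grid : forall u v, on_grid (r_weight I u v).
Hypothesis release_grid : all (fun r => on_grid (release r)) (r_requests I).

(** Rounding commutes with adding a weight on the grid. It is monotone, so waits stay nonnegative,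
    and it never drops below a grid point already passed, so release times are respected. *)
Lemma reachable_round (x : server A) : reachable x ->
  reachable (I := A) (Server (position x) (round (clock x)) (load x) (served x)).
Proof.
elim=> [|v t l S d _ r d0|u v t l S _ r uv|t S i _ r iS rel|t S i _ r] /=.
- by rewrite /round mul0r floor0 mul0r; exact: reach_start.
- rewrite -[round (t + d)](subrK (round t)) addrC; apply: reach_wait => //.
  by rewrite subr_ge0 round_mono // lerDl.
- by rewrite roundD //; exact: reach_move.
- apply: reach_pickup => //; apply: round_grid => //.
  exact: (all_tnthP (t := in_tuple _) release_grid).
- exact: reach_deliver.
Qed.

(** The rounded final clock and [r_limit I] are both multiples of [1/D], so a clock below
    [r_limit I + 1/D] is at most [r_limit I]. *)
Lemma can_earn_unsplit :
  on_grid (r_limit I) -> limit < r_limit I + D%:R^-1 ->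
  can_earn B -> can_earn A.
Proof.
move=> /intrP[m Tm] limit_lt [x [rx xT xR]].
have rA := reachable_round (split_simulated rx).
eexists; split; [exact: rA | | by rewrite /= revenue_drop].
rewrite /= /round ler_pdivrMr // Tm ler_int -ltzD1.
rewrite floor_lt_int intrD -Tm.
have := le_lt_trans xT limit_lt; rewrite -(ltr_pM2r D_pos) mulrDl.
by rewrite mulVf ?lt0r_neq0.
Qed.

End Grid.

End SplitInstance.

(** * Binary codes *)

Fixpoint bits_val (s : seq bool) : nat :=
  if s is b :: s' then (b + 2 * bits_val s')%N else 0%N.

(** The default [true] admits the empty word, which codes 0; any other word must end in a set most
    significant bit. *)
Definition canonical_bits (s : seq bool) : bool := last true s.

Definition bits (n : nat) : seq bool :=
  if bin_of_nat n is BinNums.Npos p then pos_bits p else [::].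

Lemma nat_codeE n : nat_code n = [seq Bit b | b <- bits n].
Proof. by rewrite /nat_code /bits; case: (bin_of_nat n). Qed.

Lemma pos_bitsP p :
  [/\ bits_val (pos_bits p) = nat_of_pos p, last false (pos_bits p) &
      pos_bits p != [::]].
Proof.
elim: p => [p IH|p IH|] //=; case: IH => -> l n.
  by split=> //; [rewrite NatTrec.doubleE; lia | case: (pos_bits p) l n].
by split=> //; rewrite NatTrec.doubleE; lia.
Qed.

Lemma bitsK n : bits_val (bits n) = n.
Proof.
rewrite -{2}[n]bin_of_natK /bits; case: (bin_of_nat n) => //= p.
by have [] := pos_bitsP p.
Qed.

Lemma bits_canonical n : canonical_bits (bits n).
Proof.
rewrite /bits /canonical_bits; case: (bin_of_nat n) => //= p.
by have [_] := pos_bitsP p; case: (pos_bits p).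
Qed.

Lemma bits_val_gt0 b s : canonical_bits (b :: s) -> (0 < bits_val (b :: s))%N.
Proof.
rewrite /canonical_bits; elim: s b => [[]|c s IH] //= b l.
by have /= := IH c l; lia.
Qed.

(** Parity determines the lowest bit, and a nonempty canonical word has positive value, so it cannot
    match the empty one. *)
Lemma canonical_bits_inj s t : canonical_bits s -> canonical_bits t ->
  bits_val s = bits_val t -> s = t.
Proof.
elim: s t => [|b s IH] [|c t] //.
- by move=> _ /bits_val_gt0 /=; lia.
- by move=> /bits_val_gt0 /=; lia.
move=> hs ht /= e.
have ebc : b = c by case: (b) (c) e => [] [] //=; lia.
rewrite -ebc in e *; congr cons; apply: IH; last by lia.
- by move: hs; rewrite /canonical_bits /=; case: (s).
- by move: ht; rewrite /canonical_bits /=; case: (t).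
Qed.

(** This is how codes of computed numbers are found below: exhibit a canonical word and evaluate
    it. *)
Lemma bits_unique s : canonical_bits s -> bits (bits_val s) = s.
Proof.
by move=> hs; apply: canonical_bits_inj => //;
  [exact: bits_canonical|exact: bitsK].
Qed.

Lemma bits_val_cat s t :
  bits_val (s ++ t) = (bits_val s + 2 ^ size s * bits_val t)%N.
Proof. by elim: s => [|b s IH] /=; rewrite ?expn0 ?expnS ?IH; nia. Qed.

Lemma bits_val_nseq0 k : bits_val (nseq k false) = 0%N.
Proof. by elim: k => //= k ->. Qed.

Lemma bits_val_lt s : (bits_val s < 2 ^ size s)%N.
Proof. by elim: s => // b s IH; rewrite /= expnS; case: b => /=; lia. Qed.

Lemma canonical_bits_cat s t :
  t != [::] -> canonical_bits t -> canonical_bits (s ++ t).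
Proof. by case: t => // b t _; rewrite /canonical_bits last_cat. Qed.

(** The least significant bit comes first, so dropping the initial zeros divides out the power of
    two. *)
Definition odd_part (s : seq bool) : seq bool := drop (find id s) s.

Lemma odd_partP s : s != [::] -> canonical_bits s ->
  [/\ s = nseq (size s - size (odd_part s)) false ++ odd_part s,
      odd_part s != [::], canonical_bits (odd_part s)
    & odd (bits_val (odd_part s))].
Proof.
rewrite /odd_part; elim: s => // b s IH _; case: b => [|cs] /=.
  by rewrite subnn; split=> //=; lia.
have s0 : s != [::] by case: (s) cs.
have cs' : canonical_bits s by case: (s) cs.
have [e n c o] := IH s0 cs'; split=> //.
rewrite subSn /=; last by rewrite size_drop; lia.
by rewrite -e.
Qed.

Lemma rat_code_frac (a b : nat) : (0 < b)%N -> coprime a b ->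
  rat_code (a%:R / b%:R) = nat_code a ++ Slash :: nat_code b.
Proof.
move=> b0 cab; rewrite /rat_code.
have -> : a%:R / b%:R = (Posz a)%:~R / (Posz b)%:~R :> rat by [].
rewrite coprimeq_num // coprimeq_den //=.
have -> : (Posz b == 0) = false by case: b b0 {cab}.
by rewrite gtr0_sg ?ltz_nat // mul1r.
Qed.

Lemma rat_fracE (q : rat) : 0 <= q ->
  q = `|numq q|%N%:R / `|denq q|%N%:R.
Proof.
move=> q0; rewrite -{1}(divq_num_den q) -{1}(gez0_abs (m := numq q)) ?numq_ge0 //.
by rewrite -{1}(gez0_abs (m := denq q)).
Qed.

Lemma rat_code_exp2V k :
  rat_code (2%:R ^- k) =
  Bit true :: Slash :: [seq Bit b | b <- nseq k false ++ [:: true]].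
Proof.
have -> : 2%:R ^- k = 1%:R / (2 ^ k)%:R :> rat by rewrite natrX mul1r.
rewrite rat_code_frac ?expn_gt0 ?coprime1n // nat_codeE nat_codeE.
have -> : bits (2 ^ k) = nseq k false ++ [:: true].
  rewrite -[RHS]bits_unique ?canonical_bits_cat //; congr bits.
  by rewrite bits_val_cat bits_val_nseq0 size_nseq /= muln0 addn0 muln1.
by [].
Qed.

(* If b = 2^s b' with b' odd, then a/b + 2^-(|b|+k) is, in lowest terms,
   (b' + 2^(|b'|+k) a) / (2^(|b|+k) b'). A numerator 0 has no bits and must not
   be padded, since codes have no leading zeros. *)
Definition padded_num (k : nat) (a b : seq bool) : seq bool :=
  odd_part b ++ (if a is [::] then [::] else nseq k false ++ a).

Definition padded_den (k : nat) (b : seq bool) : seq bool :=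
  nseq (size b + k) false ++ odd_part b.

Lemma bits_den_neq0 (q : rat) : bits `|denq q|%N != [::].
Proof.
apply/eqP => e; have := bitsK `|denq q|%N; rewrite e /= => /esym/eqP.
by rewrite absz_eq0 denq_eq0.
Qed.

(** Putting the length of [b] into the exponent shifts the numerator of [q] exactly past the bits of
    the odd part of [b], so the addition of numerators is a concatenation. *)
Lemma rat_code_add_exp2V (q : rat) (k : nat) : 0 <= q -> (0 < k)%N ->
  let a := bits `|numq q|%N in let b := bits `|denq q|%N in
  rat_code (q + 2%:R ^- (size b + k)) =
  [seq Bit x | x <- padded_num k a b] ++ Slash ::
  [seq Bit x | x <- padded_den k b].
Proof.
move=> q0 k0 a b.
have [eb b'0 cb' ob'] := odd_partP (bits_den_neq0 q) (bits_canonical _).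
rewrite -/b in eb b'0 cb' ob'.
set b' := odd_part b in eb b'0 cb' ob'.
have vb : `|denq q|%N = (2 ^ (size b - size b') * bits_val b')%N.
  by rewrite -(bitsK `|denq q|%N) -/b eb bits_val_cat bits_val_nseq0 size_nseq
     -eb.
have sb : (size b' <= size b)%N by rewrite size_drop leq_subr.
have va : `|numq q|%N = bits_val a by rewrite bitsK.
have vnum : bits_val (padded_num k a b) =
    (bits_val b' + 2 ^ (size b' + k) * bits_val a)%N.
  rewrite /padded_num bits_val_cat -/b'; case: (a) => [|c a'] //=.
    by rewrite !muln0.
  by rewrite bits_val_cat bits_val_nseq0 size_nseq expnD /= mulnA.
have vden : bits_val (padded_den k b) = (2 ^ (size b + k) * bits_val b')%N.
  by rewrite /padded_den bits_val_cat bits_val_nseq0 size_nseq.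
have cnum : canonical_bits (padded_num k a b).
  rewrite /padded_num; have := bits_canonical `|numq q|%N; rewrite -/a.
  case: (a) => [|c a'] ca; first by rewrite cats0.
  by rewrite catA canonical_bits_cat.
have cden : canonical_bits (padded_den k b) by rewrite canonical_bits_cat.
have b'_gt0 : (0 < bits_val b')%N by case: (bits_val b') ob'.
have -> : q + 2%:R ^- (size b + k) =
    (bits_val (padded_num k a b))%:R / (bits_val (padded_den k b))%:R.
  rewrite {1}(rat_fracE q0) va vb vnum vden.
  (* [s] is the exponent of two in the denominator of [q]; the factor [2^s] is shared by both
     summands. *)
  set s := (size b - size b')%N.
  have -> : (size b + k = s + (size b' + k))%N by rewrite /s; lia.
  move: (size b' + k)%N => m.
  rewrite !natrM natrD natrM !natrX exprD.
  have := expf_neq0 s (isT : 2%:R != 0 :> rat).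
  have := expf_neq0 m (isT : 2%:R != 0 :> rat).
  move: (2%:R ^+ s) (2%:R ^+ m) => x y y0 x0.
  by field; rewrite x0 y0 pnatr_eq0 -lt0n b'_gt0.
rewrite rat_code_frac.
- by rewrite !nat_codeE !bits_unique.
- by rewrite vden muln_gt0 expn_gt0.
(* The numerator is odd, as [k > 0] makes its second summand even; so it is prime to the power of
   two. Modulo [b'] only [2^m a] remains, with [m] the size of [b'] plus [k]: [b'] is odd, and it
   divides the denominator of [q], hence is prime to [a]. *)
rewrite vnum vden coprimeMr; apply/andP; split.
  apply: coprimeXr; rewrite coprimen2 oddD ob' oddM.
  by rewrite oddX orbF addn_eq0 (gtn_eqF k0) andbF.
rewrite coprime_sym /coprime gcdnDl -/(coprime _ _) coprimeMr; apply/andP; split.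
  by apply: coprimeXr; rewrite coprimen2.
rewrite -va coprime_sym; apply: coprime_dvdr (coprime_num_den q).
by rewrite vb dvdn_mull.
Qed.

(** * The reduction *)

Definition limit_den_size (I : rdarp) : nat := size (bits `|denq (r_limit I)|%N).

(** The exponent [2 * L] can be written by running over a counter of length [L] twice, once in each
    direction. *)
Definition reduction (I : rdarp) : rdarpb :=
  let L := size (rdarp_code I) in
  split_instance I (2%:R ^- (2 * L)) (r_limit I + 2%:R ^- (limit_den_size I + L)).

(** The plain product suffices: its bit length is bounded by the total length of the codes of its
    factors. *)
Definition common_den (I : rdarp) : nat :=
  ((\prod_(u <- enum 'I_(r_size I)) \prod_(v <- enum 'I_(r_size I))
      `|denq (r_weight I u v)|) *
   (\prod_(r <- r_requests I) `|denq (release r)|) *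
   `|denq (r_limit I)|)%N.

Lemma on_grid_dvdn D q : (`|denq q| %| D)%N -> on_grid D q.
Proof.
case/dvdnP=> m ->; rewrite /on_grid natrM -{1}(divq_num_den q).
have -> : (`|denq q|%N)%:R = (denq q)%:~R :> rat.
  by rewrite -[in RHS](gez0_abs (m := denq q)).
have d0 : (denq q)%:~R != 0 :> rat by rewrite intr_eq0 denq_neq0.
rewrite mulrCA mulrVK ?unitfE //.
by rewrite -[_%:R]/((Posz m)%:~R) -intrM.
Qed.

Lemma dvdn_prod_seq (T : eqType) (s : seq T) (F : T -> nat) x :
  x \in s -> (F x %| \prod_(y <- s) F y)%N.
Proof. by move=> xs; rewrite (big_rem x) //= dvdn_mulr. Qed.

Lemma prod_le_exp2_size (T A : Type) (s : seq T) (F : T -> nat)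
    (c : T -> seq A) :
  (forall x, F x <= 2 ^ size (c x))%N ->
  (\prod_(x <- s) F x <= 2 ^ size (flatten [seq c x | x <- s]))%N.
Proof.
move=> Fc; elim: s => [|x s IH] /=; first by rewrite big_nil.
by rewrite big_cons size_cat expnD leq_mul.
Qed.

Lemma size_nat_code n : size (nat_code n) = size (bits n).
Proof. by rewrite nat_codeE size_map. Qed.

Lemma den_le_size q : (`|denq q| <= 2 ^ size (rat_code q))%N.
Proof.
rewrite -{1}(bitsK `|denq q|%N); apply: leq_trans (ltnW (bits_val_lt _)) _.
by rewrite leq_exp2l // size_cat /= size_nat_code size_nat_code; lia.
Qed.

Lemma common_den_le I : (common_den I <= 2 ^ size (rdarp_code I))%N.
Proof.
apply: (@leq_trans (2 ^ size (matrix_code (r_weight I)) *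
   2 ^ size (requests_code (r_requests I)) * 2 ^ size (rat_code (r_limit I)))%N).
  apply: leq_mul; last exact: den_le_size.
  apply: leq_mul.
    (* The separator after each row, and below after each entry, contributes a factor 2 that is
       given away. *)
    apply: prod_le_exp2_size => u; rewrite size_rcons expnS.
    apply: leq_trans (leq_pmull _ _) => //.
    apply: prod_le_exp2_size => v; rewrite size_rcons expnS.
    by apply: leq_trans (leq_pmull _ _) => //; exact: den_le_size.
  apply: prod_le_exp2_size => r; apply: leq_trans (den_le_size _) _.
  by rewrite leq_exp2l // !size_cat /= !size_cat /= !size_cat /=; lia.
rewrite -!expnD leq_exp2l // /rdarp_code.
by do 6!rewrite !size_cat /=; lia.
Qed.

Lemma size_requests_code m n (rs : seq (request 'I_m 'I_n)) :
  (2 * size rs <= size (requests_code rs))%N.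
Proof.
elim: rs => //= r rs IH; rewrite /requests_code /= size_cat -/(requests_code rs).
by rewrite /request_code; do 3!rewrite !size_cat /=; lia.
Qed.

(** The three summands are charged to disjoint parts of the input: the denominator of the limit, the
    code of the requests, and a separator. This lets all crossings fit into the added time. *)
Lemma size_rdarp_code_ge I :
  (limit_den_size I + (2 * size (r_requests I) + 1) <= size (rdarp_code I))%N.
Proof.
have := size_requests_code (r_requests I).
rewrite /rdarp_code /limit_den_size -size_nat_code.
do 3!rewrite !size_cat /=; rewrite {2}/rat_code; do 3!rewrite !size_cat /=; lia.
Qed.

Lemma exp2V_gt0 k : 0 < 2%:R ^- k :> rat.
Proof. by rewrite invr_gt0 exprn_gt0. Qed.

Lemma reduction_valid I : rdarp_valid I -> rdarpb_valid (reduction I).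
Proof.
case=> sym diag pos [T0 R0] reqs; split=> //=.
  by move=> u v; rewrite mxE; case: eqVneq => uv; [exact: exp2V_gt0|exact: pos].
by rewrite addr_ge0 // ltW // exp2V_gt0.
Qed.

Lemma common_den_gt0 I : (0 < common_den I)%N.
Proof.
have den_gt0 q : (0 < `|denq q|)%N by rewrite absz_gt0 denq_neq0.
rewrite /common_den !muln_gt0 den_gt0 andbT; apply/andP; split.
  by apply: prodn_gt0 => u; apply: prodn_gt0 => v.
by apply: prodn_gt0.
Qed.

Lemma reduction_correct I : rdarp_valid I ->
  (can_earn (rdarp_ride I) <-> can_earn (rdarpb_ride (reduction I))).
Proof.
move=> I_valid; rewrite /reduction; set L := size _; split.
  apply: can_earn_split => //; first exact: exp2V_gt0.
  rewrite lerD2l ler_pdivrMr ?exprn_gt0 // mulrC ler_pdivlMr ?exprn_gt0 //.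
  rewrite -!natrX -natrM ler_nat.
  (* The crude bound [m < 2^m] on the number of crossings turns the claim into a comparison of
     exponents. *)
  apply: (@leq_trans (2 ^ (2 * size (r_requests I) + 1) *
                     2 ^ (limit_den_size I + L))).
    by rewrite leq_mul // ltnW // ltn_expl.
  rewrite -expnD leq_exp2l //.
  by have := size_rdarp_code_ge I; rewrite -/L; lia.
apply: (can_earn_unsplit I_valid (exp2V_gt0 _) (common_den_gt0 I)).
- move=> u v; apply: on_grid_dvdn; rewrite /common_den -mulnA dvdn_mulr //.
  apply: dvdn_trans (dvdn_prod_seq _ (mem_enum _ u)).
  exact: (dvdn_prod_seq (fun v => `|denq (r_weight I u v)|%N) (mem_enum _ v)).
- rewrite -(all_map _ (on_grid (common_den I))); apply/allP => q qs.
  apply: on_grid_dvdn; rewrite /common_den mulnAC dvdn_mull //.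
  rewrite -(big_map (@release _ _) predT (fun q => `|denq q|%N)).
  exact: (dvdn_prod_seq (fun q => `|denq q|%N)).
- by apply: on_grid_dvdn; rewrite dvdn_mull.
(* The common denominator is at most [2^L], and the denominator of the limit has at least one bit,
   so the added time is strictly below [1/D]. *)
rewrite ltrD2l ltf_pV2 ?posrE ?exprn_gt0 ?ltr0n ?common_den_gt0 //.
rewrite -natrX ltr_nat; apply: leq_ltn_trans (common_den_le I) _.
rewrite ltn_exp2l // -/L -[X in (X < _)%N]add0n ltn_add2r.
by rewrite /limit_den_size; case: (bits _) (bits_den_neq0 (r_limit I)).
Qed.

(** * Runs of Turing machines *)

Local Open Scope nat_scope.

Section Reach.
Variables (A : finType) (M : machine A).
Implicit Types (t : tape M) (c : config M).

(* Two tapes with the same head position and contents may list different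
   numbers of blanks at their ends. *)
Definition tape_eq t t' := forall i,
  nth None (tleft t) i = nth None (tleft t') i /\
  nth None (tright t) i = nth None (tright t') i.

Definition config_eq c c' := c.1 = c'.1 /\ forall i, tape_eq (c.2 i) (c'.2 i).

Lemma tape_eq_trans t1 t2 t3 : tape_eq t1 t2 -> tape_eq t2 t3 -> tape_eq t1 t3.
Proof. by move=> h1 h2 i; have [-> ->] := h1 i. Qed.

Lemma scan_eq t t' : tape_eq t t' -> scan t = scan t'.
Proof. by move=> /(_ 0) [_]; rewrite !nth0. Qed.

Lemma write_move_eq t t' a : tape_eq t t' ->
  tape_eq (write_move t a) (write_move t' a).
Proof.
move=> e; have eL i : nth None (tleft t) i = nth None (tleft t') i by case: (e i).
have eR i : nth None (tright t) i = nth None (tright t') i by case: (e i).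
case: a => x [] i; split; rewrite /write_move /=.
- by rewrite !nth_behead.
- case: i => [|[|i]] /=; rewrite ?nth_behead ?eR //.
  by rewrite -!nth0 eL.
- exact: eL.
- by case: i => [|i] //=; rewrite !nth_behead eR.
- by case: i => [|i] //=; rewrite eL.
- by rewrite !nth_behead eR.
Qed.

Lemma config_eq_trans c1 c2 c3 :
  config_eq c1 c2 -> config_eq c2 c3 -> config_eq c1 c3.
Proof.
move=> [q h] [q' h']; split; first by rewrite q.
by move=> i; apply: tape_eq_trans (h i) (h' i).
Qed.

Lemma step_eq c c' : config_eq c c' -> config_eq (step c) (step c').
Proof.
case: c c' => [q T] [q' T'] [/= <- e]; rewrite /step /=; case: ifP => // _.
have -> : [ffun i => scan (T i)] = [ffun i => scan (T' i)].
  by apply/ffunP => i; rewrite !ffunE; exact: scan_eq.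
by split=> //= i; rewrite !ffunE; exact: write_move_eq.
Qed.

Lemma iter_step_eq n c c' :
  config_eq c c' -> config_eq (iter n (@step A M) c) (iter n (@step A M) c').
Proof. by move=> e; elim: n => //= n IH; exact: step_eq. Qed.

(** An upper bound on the steps and an end point up to listed blanks: runs then compose, and their
    bounds can be relaxed. *)
Definition reach (k : nat) c c' :=
  exists2 n, n <= k & config_eq (iter n (@step A M) c) c'.

Lemma reach_refl k c : reach k c c.
Proof. by exists 0. Qed.

Lemma reach_eq k c c1 c2 : config_eq c c1 -> reach k c1 c2 -> reach k c c2.
Proof.
by move=> e [n nk r]; exists n => //; apply: config_eq_trans (iter_step_eq n e) r.
Qed.

Lemma reach_step k c c1 c2 :
  config_eq (step c) c1 -> reach k c1 c2 -> reach k.+1 c c2.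
Proof.
move=> e [n nk r]; exists n.+1 => //; rewrite iterSr.
exact: config_eq_trans (iter_step_eq n e) r.
Qed.

Lemma reach_trans k k' c1 c2 c3 :
  reach k c1 c2 -> reach k' c2 c3 -> reach (k + k') c1 c3.
Proof.
move=> [n nk r] [n' nk' r']; exists (n' + n); first by lia.
rewrite iterD; exact: config_eq_trans (iter_step_eq n' r) r'.
Qed.

Lemma reach_le k k' c c' : k <= k' -> reach k c c' -> reach k' c c'.
Proof. by move=> kk' [n nk r]; exists n => //; lia. Qed.

(** The output head ends just right of the output. A list that agrees with a blank-free word when
    extended by blanks is that word followed by blanks. *)
Lemma tape_eq_holds t (w : seq A) :
  tape_eq t (Tape (word_cells M (rev w)) [::]) -> tape_holds t w.
Proof.
have eq_pad (s u : seq (cell M)) : None \notin u ->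
    (forall i, nth None s i = nth None u i) -> exists j, s = u ++ nseq j None.
  elim: u s => [|x u IH] s; last first.
    rewrite inE negb_or eq_sym => /andP[x0 u0] e; case: s e => [|y s] e.
      by have := e 0 => /= ex; rewrite -ex eqxx in x0.
    have [j ->] := IH s u0 (fun i => e i.+1).
    by exists j; have /= -> := e 0.
  move=> _ e; exists (size s); apply: (@eq_from_nth _ None).
    by rewrite cat0s size_nseq.
  by move=> i _; rewrite e nth_nseq nth_nil; case: ifP.
move=> e.
have w0 : None \notin word_cells M (rev w) by apply/mapP => - [].
have [i ei] := eq_pad (tleft t) _ w0 (fun i => (e i).1).
have [j ej] := eq_pad (tright t) [::] isT (fun i => (e i).2).
exists i, j; rewrite ei ej rev_cat rev_nseq /word_cells map_rev revK.
by rewrite -catA.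
Qed.

End Reach.

Section TapeMoves.
Variables (A : finType) (M : machine A).
Implicit Types (l r : seq (cell M)).

(** Only up to [tape_eq], since rewriting an unlisted blank makes it a listed one. *)
Definition moves (t : tape M) (m : move) (t' : tape M) :=
  tape_eq (write_move t (scan t, m)) t'.

Lemma moves_stay (t : tape M) : moves t Stay t.
Proof.
by move=> i; split=> //; case: t => l [|x r]; case: i => //= i; rewrite nth_nil.
Qed.

Lemma moves_right l x r : moves (Tape l (x :: r)) MoveRight (Tape (x :: l) r).
Proof. by []. Qed.

Lemma moves_left x l r : moves (Tape (x :: l) r) MoveLeft (Tape l (x :: r)).
Proof.
by move=> i; split=> //; case: r => [|y r]; case: i => [|[|i]] //=;
  rewrite nth_nil.
Qed.

Lemma moves_left_end r : moves (Tape [::] r) MoveLeft (Tape [::] (None :: r)).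
Proof.
by move=> i; split=> //; case: r => [|y r]; case: i => [|[|i]] //=;
  rewrite nth_nil.
Qed.

Lemma moves_right_end r : moves (Tape [::] (None :: r)) MoveRight (Tape [::] r).
Proof. by move=> i; split=> //; case: i => //= i; rewrite nth_nil. Qed.

End TapeMoves.

(** * The reducing machine *)

(** Each line is one task: measure the input, write the number of vertices twice, rewrite the
    matrix, copy the origin, write the numerator of the new limit, start its denominator, copy what
    is left. *)
Inductive phase :=
  | Count | Rewind | RewindCounter
  | Size1 | SizeBack | Size2
  | EntryStart | EntrySlash | EpsRight | EpsLeft | EntryBody
  | Origin
  | SkipNum | SkipZeros1 | CopyDen | LimitBack | NumTest
  | PadNumRight | PadNumLeft | CopyNum
  | DenZeros | PadDenRight | PadDenLeft | DenBack | SkipZeros2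
  | CopyRest | Halted.

Definition phases : seq phase :=
  [:: Count; Rewind; RewindCounter; Size1; SizeBack; Size2; EntryStart;
      EntrySlash; EpsRight; EpsLeft; EntryBody; Origin; SkipNum; SkipZeros1;
      CopyDen; LimitBack; NumTest; PadNumRight; PadNumLeft; CopyNum; DenZeros;
      PadDenRight; PadDenLeft; DenBack; SkipZeros2; CopyRest; Halted].

Definition phase_index (q : phase) : nat :=
  match q with
  | Count => 0 | Rewind => 1 | RewindCounter => 2 | Size1 => 3 | SizeBack => 4
  | Size2 => 5 | EntryStart => 6 | EntrySlash => 7 | EpsRight => 8
  | EpsLeft => 9 | EntryBody => 10 | Origin => 11 | SkipNum => 12
  | SkipZeros1 => 13 | CopyDen => 14 | LimitBack => 15 | NumTest => 16
  | PadNumRight => 17 | PadNumLeft => 18 | CopyNum => 19 | DenZeros => 20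
  | PadDenRight => 21 | PadDenLeft => 22 | DenBack => 23 | SkipZeros2 => 24
  | CopyRest => 25 | Halted => 26
  end.

Lemma phase_indexK : cancel phase_index (nth Count phases).
Proof. by case. Qed.

HB.instance Definition _ := Countable.copy phase (can_type phase_indexK).

Lemma phases_enum : Finite.axiom phases.
Proof. by case. Qed.

HB.instance Definition _ := isFinite.Build phase phases_enum.

(* Next phase, input move, counter action (whether to write a mark, and the
   move), and symbol to append to the output. *)
Definition action : Type := (phase * move * (bool * move) * option symbol)%type.

Definition on_input (q : phase) (m : move) (o : option symbol) : action :=
  (q, m, (false, Stay), o).

Definition on_counter (q : phase) (m : move) (o : option symbol) : action :=
  (q, Stay, (false, m), o).

Definition zero : option symbol := Some (Bit false).

(** The denominator of the limit is read rightwards three times: for its odd part, which begins the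
    new numerator; for one zero per bit; and for the odd part again, which ends the new denominator
    and is copied along with the rest. *)
Definition act (q : phase) (s : option symbol) (marked : bool) : action :=
  match q with
  | Count => if s is Some _ then (Count, MoveRight, (true, MoveRight), None)
             else (Rewind, MoveLeft, (false, MoveLeft), None)
  | Rewind => if s is Some _ then on_input Rewind MoveLeft None
              else on_input RewindCounter MoveRight None
  | RewindCounter => if marked then on_counter RewindCounter MoveLeft None
                     else on_counter Size1 MoveRight None
  | Size1 => if s is Some Hash then on_input SizeBack Stay (Some Comma)
             else on_input Size1 MoveRight s
  | SizeBack => if s is Some _ then on_input SizeBack MoveLeft None
                else on_input Size2 MoveRight None
  | Size2 => on_input (if s is Some Hash then EntryStart else Size2) MoveRight s
  | EntryStart =>
      match s with
      | Some Slash => on_input EntrySlash Stay (Some (Bit true))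
      | Some Hash => on_input Origin MoveRight s
      | Some Semi => on_input EntryStart MoveRight s
      | _ => on_input EntryBody MoveRight s
      end
  | EntrySlash => on_input EpsRight MoveRight (Some Slash)
  | EpsRight => if marked then on_counter EpsRight MoveRight zero
                else on_counter EpsLeft MoveLeft None
  | EpsLeft => if marked then on_counter EpsLeft MoveLeft zero
               else on_counter EntryBody MoveRight None
  | EntryBody =>
      on_input (if s is Some Comma then EntryStart else EntryBody) MoveRight s
  | Origin => on_input (if s is Some Hash then SkipNum else Origin) MoveRight s
  | SkipNum =>
      on_input (if s is Some Slash then SkipZeros1 else SkipNum) MoveRight None
  | SkipZeros1 =>
      if s is Some (Bit false) then on_input SkipZeros1 MoveRight None
      else on_input CopyDen Stay None
  | CopyDen => if s is Some Hash then on_input LimitBack MoveLeft None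
               else on_input CopyDen MoveRight s
  | LimitBack => if s is Some Hash then on_input NumTest MoveRight None
                 else on_input LimitBack MoveLeft None
  | NumTest => if s is Some Slash then on_input CopyNum Stay None
               else on_input PadNumRight Stay None
  | PadNumRight => if marked then on_counter PadNumRight MoveRight zero
                   else on_counter PadNumLeft MoveLeft None
  | PadNumLeft => if marked then on_counter PadNumLeft MoveLeft None
                  else on_counter CopyNum MoveRight None
  | CopyNum =>
      on_input (if s is Some Slash then DenZeros else CopyNum) MoveRight s
  | DenZeros => if s is Some Hash then on_input PadDenRight Stay None
                else on_input DenZeros MoveRight zero
  | PadDenRight => if marked then on_counter PadDenRight MoveRight zero
                   else on_counter PadDenLeft MoveLeft None
  | PadDenLeft => if marked then on_counter PadDenLeft MoveLeft None
                  else on_counter DenBack MoveRight None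
  | DenBack => if s is Some Slash then on_input SkipZeros2 MoveRight None
               else on_input DenBack MoveLeft None
  | SkipZeros2 =>
      if s is Some (Bit false) then on_input SkipZeros2 MoveRight None
      else on_input CopyRest Stay None
  | CopyRest => if s is Some _ then on_input CopyRest MoveRight s
                else on_input Halted Stay None
  | Halted => on_input Halted Stay None
  end.

(** With no auxiliary symbols a mark has to be an input symbol; the machine only tests whether a
    counter cell is blank. *)
Definition mark : option (symbol + void) := Some (inl Hash).

Definition read (x : option (symbol + void)) : option symbol :=
  if x is Some (inl s) then Some s else None.

(** The output head always rests on the blank after the output, so writing a blank and staying
    changes nothing. *)
Definition out_action (o : option symbol) : option (symbol + void) * move :=
  if o is Some s then (Some (inl s), MoveRight) else (None, Stay).

Definition reducer_trans (q : phase)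
    (f : {ffun 'I_3 -> option (symbol + void)}) :
    phase * {ffun 'I_3 -> option (symbol + void) * move} :=
  let: (q', mi, (set_mark, mc), o) :=
    act q (read (f ord0)) (f (inord 1) != None) in
  (q', [ffun i : 'I_3 =>
     match val i with
     | 0 => (f i, mi)
     | 1 => (if set_mark then mark else f i, mc)
     | _ => out_action o
     end]).

Definition reducer : machine symbol :=
  @Machine symbol 2 void phase Count (pred1 Halted) reducer_trans.

Definition conf (q : phase) (ti tc : tape reducer) (out : seq symbol) :
    config reducer :=
  (q, [ffun i : 'I_3 =>
     match val i with
     | 0 => ti
     | 1 => tc
     | _ => Tape (word_cells reducer (rev out)) [::]
     end]).

Lemma step_conf (q : phase) (ti tc : tape reducer) out q' mi b mc o :
  q != Halted ->
  act q (read (scan ti)) (scan tc != None) = (q', mi, (b, mc), o) ->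
  config_eq (step (conf q ti tc out))
    (conf q' (write_move ti (scan ti, mi))
             (write_move tc (if b then mark else scan tc, mc))
             (out ++ seq_of_opt o)).
Proof.
move=> /negPf q0 e; rewrite /step /= q0 /reducer_trans !ffunE /= inordK // e.
split=> //= i; rewrite !ffunE; case: i => [[|[|[|i]]] hi] //=.
case: o {e} => [s|] /=.
  by rewrite rev_cat.
rewrite cats0 => i; split=> //.
by case: i => //= i; rewrite nth_nil.
Qed.

Lemma reach_input k (q : phase) (ti tc ti' : tape reducer) out q' m o c :
  q != Halted ->
  act q (read (scan ti)) (scan tc != None) = on_input q' m o ->
  moves ti m ti' ->
  reach k (conf q' ti' tc (out ++ seq_of_opt o)) c ->
  reach k.+1 (conf q ti tc out) c.
Proof.
move=> q0 e mi; apply: reach_step; apply: config_eq_trans (step_conf _ q0 e) _.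
split=> //= i; rewrite !ffunE; case: i => [[|[|i]] hi] //=.
exact: moves_stay.
Qed.

Lemma reach_counter k (q : phase) (ti tc tc' : tape reducer) out q' m o c :
  q != Halted ->
  act q (read (scan ti)) (scan tc != None) = on_counter q' m o ->
  moves tc m tc' ->
  reach k (conf q' ti tc' (out ++ seq_of_opt o)) c ->
  reach k.+1 (conf q ti tc out) c.
Proof.
move=> q0 e mi; apply: reach_step; apply: config_eq_trans (step_conf _ q0 e) _.
split=> //= i; rewrite !ffunE; case: i => [[|[|i]] hi] //=.
exact: moves_stay.
Qed.

(** * Loops over the input and over the counter *)

Local Notation cells := (word_cells reducer).

Definition zip_tape (l r : seq symbol) : tape reducer := Tape (cells l) (cells r).

Definition counter (i j : nat) : tape reducer :=
  Tape (M := reducer) (nseq i mark) (nseq j mark).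

Lemma scan_right (q : phase) (o : symbol -> option symbol) u l r tc out :
  q != Halted ->
  (forall x b, x \in u -> act q (Some x) b = on_input q MoveRight (o x)) ->
  reach (size u) (conf q (zip_tape l (u ++ r)) tc out)
    (conf q (zip_tape (catrev u l) r) tc (out ++ pmap o u)).
Proof.
move=> q0; elim: u l out => [|x u IH] l out h /=.
  by rewrite cats0; exact: reach_refl.
apply: (reach_input q0); first by rewrite /= h ?mem_head.
  exact: moves_right.
have -> : out ++ oapp (cons^~ (pmap o u)) (pmap o u) (o x) =
    (out ++ seq_of_opt (o x)) ++ pmap o u.
  by rewrite -catA; case: (o x).
by apply: (IH (x :: l)) => y b yu; apply: h; rewrite inE yu orbT.
Qed.

(** [lc] is what lies beyond the scanned word: a landmark symbol with its surroundings, or nothing,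
    in which case the head stops on a blank. *)
Lemma scan_left (q : phase) u lc x r tc out : q != Halted ->
  (forall y b, y \in x :: u -> act q (Some y) b = on_input q MoveLeft None) ->
  reach (size u).+1 (conf q (Tape (cells u ++ lc) (cells (x :: r))) tc out)
    (conf q (Tape (behead lc) (head None lc :: cells (catrev u (x :: r)))) tc
      out).
Proof.
move=> q0; elim: u x r => [|y u IH] x r h.
  apply: (reach_input q0 (o := None)
    (ti' := Tape (behead lc) (head None lc :: cells (x :: r)))).
  - by rewrite /= h ?mem_head.
  - by case: (lc) => [|z l]; [exact: moves_left_end|exact: moves_left].
  by rewrite cats0; exact: reach_refl.
apply: (reach_input q0 (o := None)); first by rewrite /= h ?mem_head.
  exact: moves_left.
rewrite cats0; apply: (IH y (x :: r)) => z b zu; apply: h.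
by rewrite inE zu orbT.
Qed.

Lemma sweep_right (q : phase) o ti i j out : q != Halted ->
  (forall s, act q s true = on_counter q MoveRight o) ->
  reach j (conf q ti (counter i j) out)
    (conf q ti (counter (i + j) 0) (out ++ pmap id (nseq j o))).
Proof.
move=> q0 h; elim: j i out => [|j IH] i out.
  by rewrite addn0 cats0; exact: reach_refl.
apply: (reach_counter q0); first by rewrite /= h.
  exact: moves_right.
have -> : out ++ pmap id (nseq j.+1 o) =
    (out ++ seq_of_opt o) ++ pmap id (nseq j o).
  by rewrite -catA /=; case: (o).
by rewrite addnS -addSn; apply: (IH i.+1).
Qed.

Lemma sweep_left (q : phase) o ti i j out : q != Halted ->
  (forall s, act q s true = on_counter q MoveLeft o) ->
  reach i.+1 (conf q ti (counter i j.+1) out)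
    (conf q ti (Tape (M := reducer) [::] (None :: nseq (i + j.+1) mark))
      (out ++ pmap id (nseq i.+1 o))).
Proof.
move=> q0 h; elim: i j out => [|i IH] j out.
  apply: (reach_counter q0); first by rewrite /= h.
    exact: moves_left_end.
  by rewrite /=; case: (o) => [x|] /=; exact: reach_refl.
apply: (reach_counter q0); first by rewrite /= h.
  exact: moves_left.
have -> : out ++ pmap id (nseq i.+2 o) =
    (out ++ seq_of_opt o) ++ pmap id (nseq i.+1 o).
  by rewrite -catA [nseq i.+2 o]/= /=; case: (o).
by rewrite addSn -addnS; apply: (IH j.+1).
Qed.

(** The way out writes [k] zeros; the way back writes [k] more for the weight [eps] and none for the
    limit. Each way takes [k] steps, plus one to turn and one to leave the blank before the
    counter. *)
Lemma sweep (q1 q2 q3 : phase) o ti k out :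
  q1 != Halted -> q2 != Halted -> 0 < k ->
  (forall s, act q1 s true = on_counter q1 MoveRight zero) ->
  (forall s, act q1 s false = on_counter q2 MoveLeft None) ->
  (forall s, act q2 s true = on_counter q2 MoveLeft o) ->
  (forall s, act q2 s false = on_counter q3 MoveRight None) ->
  reach (2 * k + 2) (conf q1 ti (counter 0 k) out)
    (conf q3 ti (counter 0 k)
      (out ++ nseq k (Bit false) ++ pmap id (nseq k o))).
Proof.
move=> q10 q20; case: k => // k _ h1 h2 h3 h4.
have r1 := sweep_right ti 0 k.+1 out q10 h1.
have r3 := @sweep_left q2 o ti k 0 (out ++ nseq k.+1 (Bit false)) q20 h3.
have e : pmap id (nseq k.+1 zero) = nseq k.+1 (Bit false).
  by elim: (k.+1) => //= j ->.
rewrite add0n e in r1; rewrite addn1 in r3.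
apply: (@reach_le _ _ (k.+1 + (k.+1 + 1).+1)); first by lia.
apply: reach_trans r1 _; apply: (reach_counter q10); first by rewrite /= h2.
  exact: moves_left.
rewrite cats0; apply: reach_trans r3 _; apply: (reach_counter q20).
- by rewrite /= h4.
- exact: moves_right_end.
by rewrite cats0 -catA; exact: reach_refl.
Qed.

(** These leave the step count as an existential variable, assembled along a run and compared with
    the stated bound at its end. *)
Ltac input_step lem :=
  eapply reach_input; [exact: isT | reflexivity | exact: lem | rewrite ?cats0].

Ltac counter_step lem :=
  eapply reach_counter; [exact: isT | reflexivity | exact: lem | rewrite ?cats0].

(** * The phases, in the order of a run *)

Lemma count_right l u i :
  reach (size u) (conf Count (zip_tape l u) (counter i 0) [::])
    (conf Count (zip_tape (catrev u l) [::]) (counter (i + size u) 0) [::]).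
Proof.
elim: u l i => [|x u IH] l i /=; first by rewrite addn0; exact: reach_refl.
apply: (@reach_step _ _ _ _
  (conf Count (zip_tape (x :: l) u) (counter i.+1 0) [::])).
  exact: (@step_conf Count (zip_tape l (x :: u)) (counter i 0) [::] _ _ _ _ _
    isT erefl).
by rewrite addnS -addSn; apply: (IH (x :: l)).
Qed.

Lemma init_conf w :
  config_eq (init reducer w) (conf Count (zip_tape [::] w) (counter 0 0) [::]).
Proof. by split=> //= i; rewrite !ffunE; case: i => [[|[|i]] hi]. Qed.

Lemma count_rewind w : w != [::] ->
  reach (4 * size w + 4) (init reducer w)
    (conf Size1 (zip_tape [::] w) (counter 0 (size w)) [::]).
Proof.
move=> w0; apply: reach_eq (init_conf w) _.
have := count_right [::] w 0; rewrite add0n => r1.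
have ew : rev w = catrev w [::] by [].
case E: (rev w) => [|x l]; first by rewrite -[w]revK E in w0.
have wE : w = catrev l [:: x] by rewrite -[w]revK E /rev /=.
rewrite -ew E in r1; have [k kE] : exists k, size w = k.+1.
  by case: (w) w0 => // a s _; exists (size s).
have lk : size l = k by apply: succn_inj; rewrite -kE -(size_rev w) E.
eapply reach_le; last first.
  apply: reach_trans r1 _; rewrite kE.
  (* At the turn both heads move left together, onto the last symbol and the last mark. *)
  apply: (@reach_step _ _ _ _
    (conf Rewind (zip_tape l [:: x]) (counter k 1) [::])).
    apply: config_eq_trans (@step_conf Count (zip_tape (x :: l) [::])
      (counter k.+1 0) [::] _ _ _ _ _ isT erefl) _.
    split=> //= i; rewrite !ffunE; case: i => [[|[|i]] hi] //=; exact: moves_left.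
  apply: reach_trans.
    have := @scan_left Rewind l [::] x [::] (counter k 1) [::] isT.
    rewrite cats0 -wE; apply; by [].
  input_step moves_right_end.
  apply: reach_trans.
    have := @sweep_left RewindCounter None (zip_tape [::] w) k 0 [::] isT.
    by apply.
  have -> : pmap id (nseq k.+1 (None : option symbol)) = [::] by elim: (k.+1).
  counter_step moves_right_end.
  rewrite addn1; exact: (reach_refl 0).
by rewrite kE lk; lia.
Qed.

Lemma pmap_Some (T : Type) (s : seq T) : pmap Some s = s.
Proof. by elim: s => //= x s ->. Qed.

Lemma pmap_None (S T : Type) (s : seq S) : pmap (fun=> None : option T) s = [::].
Proof. by elim: s. Qed.

Lemma pmap_cst (S T : Type) (y : T) (s : seq S) :
  pmap (fun=> Some y) s = nseq (size s) y.
Proof. by elim: s => //= x s ->. Qed.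

Lemma pmap_nseq (T : Type) (o : option T) k :
  pmap id (nseq k o) = if o is Some y then nseq k y else [::].
Proof. by case: o => [y|]; elim: k => //= k ->. Qed.

Lemma catrev_cat (T : Type) (s t u : seq T) :
  catrev (s ++ t) u = catrev t (catrev s u).
Proof. by elim: s u => //= x s IH u. Qed.

Local Notation bitseq_code s := [seq Bit b | b <- s].

Lemma copy_right (q : phase) u l r tc out : q != Halted ->
  (forall x b, x \in u -> act q (Some x) b = on_input q MoveRight (Some x)) ->
  reach (size u) (conf q (zip_tape l (u ++ r)) tc out)
    (conf q (zip_tape (catrev u l) r) tc (out ++ u)).
Proof. by move=> q0 h; have := scan_right l r tc out q0 h; rewrite pmap_Some. Qed.

Lemma skip_right (q : phase) u l r tc out : q != Halted ->
  (forall x b, x \in u -> act q (Some x) b = on_input q MoveRight None) ->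
  reach (size u) (conf q (zip_tape l (u ++ r)) tc out)
    (conf q (zip_tape (catrev u l) r) tc out).
Proof.
by move=> q0 h; have := scan_right l r tc out q0 h; rewrite pmap_None cats0.
Qed.

Lemma duplicate_size s r tc :
  reach (3 * size s + 4)
    (conf Size1 (zip_tape [::] (bitseq_code s ++ Hash :: r)) tc [::])
    (conf EntryStart (zip_tape (Hash :: rev (bitseq_code s)) r) tc
      (bitseq_code s ++ Comma :: bitseq_code s ++ [:: Hash])).
Proof.
set u := bitseq_code s.
eapply reach_le; last first.
  apply: reach_trans.
    by apply: copy_right => // x b /mapP[c _ ->].
  input_step moves_stay.
  apply: reach_trans.
    have := @scan_left SizeBack (catrev u [::]) [::] Hash r tc
      ([::] ++ u ++ [:: Comma]) isT.
    by rewrite cats0; apply.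
  input_step moves_right_end.
  have -> : catrev (catrev u [::]) (Hash :: r) = u ++ Hash :: r.
    by rewrite catrevE -/(rev u) revK.
  apply: reach_trans.
    by apply: (@copy_right Size2 u [::]) => // x b /mapP[c _ ->].
  input_step moves_right.
  rewrite /= -!catA /=; exact: (reach_refl 0).
by rewrite -/(rev u) size_rev size_map; lia.
Qed.

Lemma rat_codeE q : rat_code q =
  bitseq_code (bits `|numq q|%N) ++ Slash :: bitseq_code (bits `|denq q|%N).
Proof. by rewrite /rat_code !nat_codeE. Qed.

Lemma bits_num_eq0 (q : rat) : (bits `|numq q|%N == [::]) = (q == 0%R).
Proof.
rewrite -numq_eq0 -absz_eq0; apply/eqP/eqP => [e|-> //].
by rewrite -[LHS]bitsK e.
Qed.

(** The machine does not track indices; on valid instances an entry is zero exactly on the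
    diagonal. *)
Definition unzero (L : nat) (q : rat) : rat :=
  if (q == 0)%R then (2%:R ^- (2 * L))%R else q.

Definition entry_code (q : rat) : seq symbol := rcons (rat_code q) Comma.

(** Charging each symbol the price of a full sweep makes the bound additive over entries and
    rows. *)
Lemma entry_reach L q l r out : 0 < L ->
  reach ((2 * L + 10) * size (entry_code q))
    (conf EntryStart (zip_tape l (entry_code q ++ r)) (counter 0 L) out)
    (conf EntryStart (zip_tape (catrev (entry_code q) l) r) (counter 0 L)
      (out ++ entry_code (unzero L q))).
Proof.
move=> L0; rewrite /unzero; case: ifP => [/eqP ->|/negbT q0].
  (* The machine writes a 1, the slash and [2 * L] zeros; the denominator 1 and the comma of the
     zero entry, copied next, complete the code of [eps]. *)
  have e0 : entry_code 0 = [:: Slash; Bit true; Comma] by [].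
  rewrite e0 /entry_code rat_code_exp2V.
  eapply reach_le; last first.
    input_step moves_stay.
    input_step moves_right.
    apply: reach_trans.
      by apply: (sweep (q2 := EpsLeft) (q3 := EntryBody) (o := zero)).
    rewrite pmap_nseq.
    input_step moves_right.
    input_step moves_right.
    have -> : out ++ rcons (Bit true :: Slash ::
          bitseq_code (nseq (2 * L) false ++ [:: true])) Comma =
        ((((out ++ [:: Bit true]) ++ [:: Slash]) ++ nseq L (Bit false) ++
          nseq L (Bit false)) ++ [:: Bit true]) ++ [:: Comma].
      by rewrite mul2n -addnn nseqD !map_cat map_nseq -cats1 -!catA /= -!catA.
    exact: (reach_refl 0).
  by rewrite /=; lia.
rewrite /entry_code rat_codeE; have := bits_num_eq0 q; rewrite (negPf q0).
case: (bits `|numq q|) => // c s _; set d := bits _.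
pose m := bitseq_code s ++ Slash :: bitseq_code d.
rewrite -[bitseq_code (c :: s) ++ _]/(Bit c :: m).
have -> : catrev (rcons (Bit c :: m) Comma) l = Comma :: catrev m (Bit c :: l).
  by rewrite -cats1 catrev_cat.
eapply reach_le; last first.
  rewrite -cats1 -catA.
  input_step moves_right.
  apply: reach_trans.
    apply: (@copy_right EntryBody m (Bit c :: l) (Comma :: r)) => // x b.
    by rewrite mem_cat inE => /or3P[/mapP[y _ ->]|/eqP->|/mapP[y _ ->]].
  input_step moves_right.
  have -> : out ++ (Bit c :: m) ++ [:: Comma] =
      ((out ++ [:: Bit c]) ++ m) ++ [:: Comma].
    by move: (m) => m'; rewrite -!catA.
  exact: (reach_refl 0).
by rewrite size_rcons /=; nia.
Qed.

Definition row_code (row : seq rat) : seq symbol :=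
  rcons (flatten [seq entry_code q | q <- row]) Semi.

Definition rows_code (rows : seq (seq rat)) : seq symbol :=
  flatten [seq row_code row | row <- rows].

Lemma row_reach L row l r out : 0 < L ->
  reach ((2 * L + 10) * size (row_code row))
    (conf EntryStart (zip_tape l (row_code row ++ r)) (counter 0 L) out)
    (conf EntryStart (zip_tape (catrev (row_code row) l) r) (counter 0 L)
      (out ++ row_code [seq unzero L q | q <- row])).
Proof.
move=> L0; elim: row l out => [|q row IH] l out /=.
  eapply reach_le; last first.
    input_step moves_right; exact: (reach_refl 0).
  by lia.
rewrite /row_code /= !rcons_cat size_cat mulnDr -catA.
rewrite -/(row_code row) catA catrev_cat.
rewrite -catA; apply: reach_trans; first exact: entry_reach.
by rewrite catA; apply: IH.
Qed.

Lemma rows_reach L rows l r out : 0 < L ->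
  reach ((2 * L + 10) * size (rows_code rows))
    (conf EntryStart (zip_tape l (rows_code rows ++ r)) (counter 0 L) out)
    (conf EntryStart (zip_tape (catrev (rows_code rows) l) r) (counter 0 L)
      (out ++ rows_code [seq [seq unzero L q | q <- row] | row <- rows])).
Proof.
move=> L0; elim: rows l out => [|row rows IH] l out /=.
  by rewrite cats0; exact: reach_refl.
rewrite /rows_code /= size_cat mulnDr -catA catrev_cat -/(rows_code rows).
apply: reach_trans; first exact: row_reach.
by rewrite catA; apply: IH.
Qed.

(** The hash before the numerator is the landmark for the way back. Since [b] is canonical and
    nonempty, it contains a set bit, where the skipping of zeros stops. *)
Lemma limit_reach L a b l r out : 0 < L -> b != [::] -> canonical_bits b ->
  reach (8 * (size a + size b + size r) + 4 * L + 40)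
    (conf SkipNum (zip_tape (Hash :: l)
        (bitseq_code a ++ Slash :: bitseq_code b ++ Hash :: r)) (counter 0 L) out)
    (conf Halted (zip_tape
        (catrev (bitseq_code a ++ Slash :: bitseq_code b ++ Hash :: r) (Hash :: l))
        [::])
      (counter 0 L)
      (out ++ bitseq_code (padded_num L a b) ++ Slash ::
       bitseq_code (padded_den L b) ++ Hash :: r)).
Proof.
move=> L0 b0 cb; have [eb b'0 _ ob'] := odd_partP b0 cb.
have isbit (s : seq bool) x : x \in bitseq_code s -> exists c, x = Bit c.
  by case/mapP=> c _ ->; exists c.
set u := bitseq_code a; set v := bitseq_code b.
set z := bitseq_code (nseq (size b - size (odd_part b)) false).
set v' := bitseq_code (odd_part b).
have vE : v = z ++ v' by rewrite /v {1}eb map_cat.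
have zE x : x \in z -> x = Bit false.
  by case/mapP=> c /nseqP[-> _] ->.
have [v1 v1E] : exists v1, v' = Bit true :: v1.
  rewrite /v'; case: (odd_part b) b'0 ob' => // - [] s _ /=.
    by move=> _; exists (bitseq_code s).
  by rewrite add0n mul2n odd_double.
have v'v x : x \in v' -> exists c, x = Bit c by apply: isbit.
(* [w] is the code of the limit in the order in which [LimitBack] meets it. *)
pose w := catrev v (Slash :: catrev u [::]).
have wP x : x \in w -> x = Slash \/ exists c, x = Bit c.
  rewrite /w catrevE mem_cat inE catrevE cats0 !mem_rev.
  by case/or3P=> [/isbit|/eqP->|/isbit]; auto.
have [y [w' wE]] : exists y w', w = y :: w'.
  rewrite /w vE v1E catrevE rev_cat rev_cons -cats1.
  by case: (rev v1) => /=; eauto.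
have wl : catrev v (Slash :: catrev u (Hash :: l)) = y :: w' ++ Hash :: l.
  by rewrite -cat_cons -wE /w !catrevE -!catA /= cats0.
have wr : catrev w' (y :: Hash :: r) = u ++ Slash :: v ++ Hash :: r.
  rewrite -[LHS]/(catrev (y :: w') (Hash :: r)) -wE /w !catrevE.
  by rewrite rev_cat !rev_cons !revK cats0 -cats1 revK -!catA.
have szw : size w' <= size a + size b.
  have := congr1 size wE; rewrite /w !catrevE !size_cat /=.
  by rewrite !size_cat !size_rev /= !size_map; lia.
have sv : size v = size b by rewrite size_map.
have su : size u = size a by rewrite size_map.
have szv' : size z + size v' = size b by rewrite -size_cat -vE.
pose pad := if a is [::] then [::] else nseq L (Bit false).
have padE : bitseq_code (padded_num L a b) = v' ++ pad ++ u.
  rewrite /padded_num map_cat -/v' /pad /u; case: (a) => //= c a'.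
  by rewrite map_cat map_nseq.
have denE : bitseq_code (padded_den L b) =
    nseq (size v) (Bit false) ++ nseq L (Bit false) ++ v'.
  by rewrite /padded_den map_cat map_nseq nseqD -catA sv.
have toNum : reach (2 * L + 3)
    (conf NumTest (zip_tape (Hash :: l) (u ++ Slash :: v ++ Hash :: r))
      (counter 0 L) (out ++ v'))
    (conf CopyNum (zip_tape (Hash :: l) (u ++ Slash :: v ++ Hash :: r))
      (counter 0 L) (out ++ v' ++ pad)).
  rewrite /u /pad; case: (a) => [|c a'].
    eapply reach_le; last first.
      input_step moves_stay.
      exact: (reach_refl 0).
    by lia.
  eapply reach_le; last first.
    input_step moves_stay.
    apply: reach_trans.
      by apply: (sweep (q2 := PadNumLeft) (q3 := CopyNum) (o := None)).
    by rewrite pmap_nseq cats0 -catA; exact: (reach_refl 0).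
  by lia.
eapply reach_le; last first.
  apply: reach_trans.
    by apply: skip_right => // x b1 /isbit[c ->].
  input_step moves_right.
  rewrite vE -catA.
  apply: reach_trans.
    by apply: (@skip_right SkipZeros1 z (Slash :: catrev u (Hash :: l))) =>
      // x b1 /zE ->.
  eapply reach_input; [exact: isT | rewrite v1E; reflexivity
                      | exact: moves_stay |].
  rewrite cats0.
  apply: reach_trans.
    by apply: copy_right => // x b1 /v'v[c ->].
  rewrite -catrev_cat -vE wl.
  input_step moves_left.
  apply: reach_trans.
    have := @scan_left LimitBack w' (cells (Hash :: l)) y (Hash :: r)
      (counter 0 L) (out ++ v') isT.
    rewrite -map_cat; apply=> x b1; rewrite -wE => /wP[->|[c ->]] //.
  rewrite wr.
  input_step moves_right.
  apply: reach_trans; first exact: toNum.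
  apply: reach_trans.
    by apply: copy_right => // x b1 /isbit[c ->].
  input_step moves_right.
  apply: reach_trans.
    apply: (@scan_right DenZeros (fun=> zero) v
      (Slash :: catrev u (Hash :: l))) => //.
    by move=> x b1 /isbit[c ->].
  rewrite pmap_cst.
  input_step moves_stay.
  apply: reach_trans.
    by apply: (sweep (q2 := PadDenLeft) (q3 := DenBack) (o := None)).
  rewrite pmap_nseq cats0.
  apply: reach_trans.
    have := @scan_left DenBack (rev v) (cells (Slash :: catrev u (Hash :: l)))
      Hash r (counter 0 L).
    move=> h; rewrite /zip_tape catrevE /word_cells map_cat.
    apply: h => // x b1; rewrite inE mem_rev => /orP[/eqP->|/isbit[c ->]] //.
  input_step moves_right.
  rewrite [catrev (rev v) _]catrevE revK vE -catA.
  apply: reach_trans.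
    by apply: (@skip_right SkipZeros2 z (Slash :: catrev u (Hash :: l))) =>
      // x b1 /zE ->.
  eapply reach_input; [exact: isT | rewrite v1E; reflexivity
                      | exact: moves_stay |].
  (* [CopyRest] runs up to the blank after the input, so nothing remains to its right. *)
  rewrite cats0 -[v' ++ _]cats0.
  apply: reach_trans.
    by apply: copy_right => //.
  input_step moves_stay.
  rewrite padE denE.
  rewrite catrev_cat /= !catrev_cat -!catA -vE; exact: (reach_refl 0).
rewrite size_rev size_cat /= -/v sv su.
move: szw szv'; move: (size z) (size v') (size w') (size a) (size b) (size r).
move=> n1 n2 n3 n4 n5 n6; clear => h1 h2.
lia.
Qed.

(** * The complete run and its running time *)

Definition matrix_rows (m n : nat) (w : 'M[rat]_(m, n)) : seq (seq rat) :=
  [seq [seq w i j | j <- enum 'I_n] | i <- enum 'I_m].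

Lemma matrix_codeE m n (w : 'M[rat]_(m, n)) :
  matrix_code w = rows_code (matrix_rows w).
Proof.
rewrite /matrix_code /rows_code /matrix_rows -map_comp; congr flatten.
by apply: eq_map => i /=; rewrite /row_code -map_comp.
Qed.

Lemma reduction_rows I : rdarp_valid I ->
  matrix_rows (b_weight (reduction I)) =
  [seq [seq unzero (size (rdarp_code I)) q | q <- row]
  | row <- matrix_rows (r_weight I)].
Proof.
case=> _ diag pos _ _; rewrite /matrix_rows -map_comp; apply: eq_map => i /=.
rewrite -map_comp; apply: eq_map => j /=; rewrite mxE /unzero.
by case: eqVneq => [<-|ij]; [rewrite diag eqxx | rewrite gt_eqF ?pos].
Qed.

Lemma reducer_computes I : rdarp_valid I ->
  computes_within reducer (rdarp_code I) (rdarpb_code (reduction I))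
    (100 * size (rdarp_code I) ^ 2 + 100).
Proof.
move=> I_valid; have rowsE := reduction_rows I_valid.
set L := size (rdarp_code I) in rowsE *.
set n := bits (r_size I); set o := bits (r_origin I).
set a := bits `|numq (r_limit I)|; set b := bits `|denq (r_limit I)|.
set rest := requests_code (r_requests I) ++ Hash :: rat_code (r_threshold I).
set rows := matrix_rows (r_weight I) in rowsE.
have codeE : rdarp_code I =
    [seq Bit x | x <- n] ++ Hash :: rows_code rows ++ Hash ::
    [seq Bit x | x <- o] ++ Hash :: [seq Bit x | x <- a] ++ Slash ::
    [seq Bit x | x <- b] ++ Hash :: rest.
  by rewrite /rdarp_code matrix_codeE rat_codeE !nat_codeE -catA.
have L0 : 0 < L by rewrite /L codeE size_cat /=; lia.
have T0 : (0 <= r_limit I)%R by case: I_valid => _ _ _ [].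
have outE : rdarpb_code (reduction I) =
    ([seq Bit x | x <- n] ++ Comma :: [seq Bit x | x <- n] ++ [:: Hash]) ++
    rows_code [seq [seq unzero L q | q <- row] | row <- rows] ++ Hash ::
    [seq Bit x | x <- o] ++ Hash ::
    [seq Bit x | x <- padded_num L a b] ++ Slash ::
    [seq Bit x | x <- padded_den L b] ++ Hash :: rest.
  rewrite /rdarpb_code matrix_codeE rowsE /= rat_code_add_exp2V //.
  by rewrite !nat_codeE -!catA /= -!catA.
have b0 : b != [::] := bits_den_neq0 _.
have cb : canonical_bits b := bits_canonical _.
have code0 : rdarp_code I != [::] by rewrite -size_eq0 -lt0n.
have [ti [t tle r]] : exists ti, reach (100 * L ^ 2 + 100)
    (init reducer (rdarp_code I))
    (conf Halted ti (counter 0 L) (rdarpb_code (reduction I))).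
  eexists.
  eapply reach_le; last first.
    apply: reach_trans; first exact: count_rewind.
    rewrite -/L outE codeE.
    apply: reach_trans; first exact: duplicate_size.
    apply: reach_trans; first exact: (rows_reach _ _ _ _ L0).
    input_step moves_right.
    apply: reach_trans.
      apply: (@copy_right Origin [seq Bit x | x <- o]
        (Hash :: catrev (rows_code rows) (Hash :: rev [seq Bit x | x <- n]))) =>
        //.
      by move=> x c /mapP[d _ ->].
    input_step moves_right.
    apply: reach_trans.
      exact: (@limit_reach L a b (catrev [seq Bit x | x <- o]
        (Hash :: catrev (rows_code rows) (Hash :: rev [seq Bit x | x <- n])))).
    rewrite -!catA; exact: (reach_refl 0).
  have sL : size n + size o + size a + size b + size rest +
      size (rows_code rows) <= L.
    rewrite /L codeE; move: (rest) => s; do 5!rewrite size_cat /=.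
    rewrite !size_map.
    by move: (size n) (size o) (size a) (size b) => k1 k2 k3 k4; lia.
  rewrite -/L size_map.
  move: sL L0; move: (L) (size n) (size o) (size a) (size b) (size rest).
  move: (size (rows_code rows)) => n1 n2 n3 n4 n5 n6 n7 sL L0.
  (* Only the matrix pass is quadratic: its code has at most [L] symbols, each charged [2 * L + 10]
     steps. *)
  have : (2 * n2 + 10) * n1 <= (2 * n2 + 10) * n2 by rewrite leq_mul2l; lia.
  by nia.
exists t => //=; case: r => /= -> /(_ ord_max); rewrite ffunE /= => r.
by split=> //; exact: tape_eq_holds.
Qed.

Theorem theorem5 :
  poly_reducible RDARP RDARP_B /\
  poly_reducible RDARP_uniform RDARP_B_uniform.
Proof.
split; exists reduction; split.
- exact: reduction_valid.
- exact: reduction_correct.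
- by exists reducer, 100, 2; exact: reducer_computes.
(* The requests are unchanged by the reduction, so their revenues stay uniform. *)
- by move=> I [I_valid unif]; split=> //; exact: reduction_valid.
- by move=> I [I_valid _]; exact: reduction_correct.
- by exists reducer, 100, 2 => I [I_valid _]; exact: reducer_computes.
Qed.
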